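(* Let $G:\mathcal{D}_G\to\mathcal{T}_\Lambda$ be the $QR$ iteration with Rayleigh quotient shift. There exist $\epsilon>0$ and $c>0$ such that $\Delta_\epsilon\subset\mathcal{D}_G$, $G(\Delta_\epsilon)\subset\Delta_\epsilon$ and, for all $T\in\Delta_\epsilon$, $$|(G(T))_{n,n-1}|\le c\,|(T)_{n,n-1}|^3.$$
   Context: Fix real numbers $\lambda_1 < \cdots < \lambda_n$ ($n\ge2$), $\Lambda = \operatorname{diag}(\lambda_1,\ldots,\lambda_n)$ and $\sigma(\Lambda)=\{\lambda_1,\ldots,\lambda_n\}$. Let $\mathcal{T}_\Lambda$ be the set of real symmetric tridiagonal $n\times n$ matrices conjugate to $\Lambda$, a compact smooth submanifold of the space of real symmetric tridiagonal matrices. $Q^*$ denotes the transpose and $O(n)$ the real orthogonal group. For invertible real $M$, $M = \mathbf{Q}(M)\mathbf{R}(M)$ is the unique $QR$ factorization with $\mathbf{Q}(M)\in O(n)$ and $\mathbf{R}(M)$ upper triangular with positive diagonal. A matrix $M$ is $LU$-positive if it admits a (unique) factorization $M = LU$ with $L=\mathbf{L}(M)$ lower triangular with unit diagonal and $U$ upper triangular with positive diagonal entries. For $\pi \in S_n$, let $\lambda^\pi_i=\lambda_{\pi(i)}$ and $\Lambda^\pi = \operatorname{diag}(\lambda^\pi_1,\ldots,\lambda^\pi_n)$. The chart domain $\mathcal{U}^\pi_\Lambda\subset\mathcal{T}_\Lambda$ is the open set of $T\in\mathcal{T}_\Lambda$ for which there is a (necessarily unique) $LU$-positive $Q_\pi\in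 O(n)$ with $T = Q_\pi^*\Lambda^\pi Q_\pi$. For such $T$ let $L_\pi=\mathbf{L}(Q_\pi)$ and $B_\pi=L_\pi^{-1}\Lambda^\pi L_\pi$; this matrix is lower bidiagonal, and its subdiagonal entries $\beta^\pi_i=(B_\pi)_{i+1,i}$ are the $\pi$-bidiagonal coordinates of $T$. The map $\psi_\pi:\mathcal{U}^\pi_\Lambda\to\mathbb{R}^{n-1}$, $\psi_\pi(T)=(\beta^\pi_1,\ldots,\beta^\pi_{n-1})$, is a diffeomorphism; its inverse is denoted $\phi_\pi$. For $s\in\mathbb{R}\smallsetminus\sigma(\Lambda)$ and $T\in\mathcal{T}_\Lambda$, let $\mathbf{F}(s,T)=\mathbf{Q}(T-sI)^*\,T\,\mathbf{Q}(T-sI)\in\mathcal{T}_\Lambda$. The map $\mathbf{F}$ extends continuously to the open set $$\mathcal{D}_{\mathbf{F}}=\big((\mathbb{R}\smallsetminus\sigma(\Lambda))\times\mathcal{T}_\Lambda\big)\cup\bigcup_{i=1}^n\Big(\{\lambda_i\}\times\bigcup_{\pi\in S_n,\ \pi(n)=i}\mathcal{U}^\pi_\Lambda\Big)\subset\mathbb{R}\times\mathcal{T}_\Lambda,$$ where it is given by $$\mathbf{F}(s,\phi_\pi(\beta^\pi_1,\ldots,\beta^\pi_{n-1}))=\phi_\pi\left(\left|\frac{\lambda^\pi_2-s}{\lambda^\pi_1-s}\right|\beta^\pi_1,\ldots,\left|\frac{\lambda^\pi_n-s}{\lambda^\pi_{n-1}-s}\right|\beta^\pi_{n-1}\right)$$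 (for any $\pi$ if $s\notin\sigma(\Lambda)$, and for $\pi$ with $\pi(n)=i$ if $s=\lambda_i$). The $QR$ iteration with Rayleigh quotient shift is $G:\mathcal{D}_G\to\mathcal{T}_\Lambda$, $G(T)=\mathbf{F}((T)_{n,n},T)$, where $\mathcal{D}_G=\{T\in\mathcal{T}_\Lambda : ((T)_{n,n},T)\in\mathcal{D}_{\mathbf{F}}\}$, an open subset of $\mathcal{T}_\Lambda$. For $\epsilon>0$, the deflation neighborhood $\Delta_\epsilon$ is the set of $T\in\mathcal{T}_\Lambda$ with $|(T)_{n,n-1}|\le\epsilon$. *)

(* Defs.v *)
From HB Require Import structures.
From mathcomp Require Import all_boot all_order all_fingroup all_algebra.
From mathcomp Require Import mxred.
From mathcomp Require Import all_classical all_reals all_analysis.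

Set Implicit Arguments.
Unset Strict Implicit.
Unset Printing Implicit Defensive.
Import Order.TTheory GRing.Theory Num.Theory numFieldNormedType.Exports.

Local Open Scope classical_set_scope.
Local Open Scope ring_scope.

Section MatrixClasses.
Context {R : realType} {n : nat}.
Implicit Types M L U Q : 'M[R]_n.

Definition orthogonal_mx Q : Prop := Q^T *m Q = 1%:M.

Definition tridiagonal_mx M : Prop :=
  forall i j : 'I_n, (i.+1 < j)%N || (j.+1 < i)%N -> M i j = 0.

(* [is_trig_mx] is lower triangularity. *)
Definition unit_lower_mx L : Prop := is_trig_mx L /\ forall i, L i i = 1.

Definition pos_upper_mx U : Prop := is_trig_mx U^T /\ forall i, 0 < U i i.

Definition LU_positive M : Prop :=
  exists L U, [/\ unit_lower_mx L, pos_upper_mx U & M = L *m U].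

(* Meaningful for invertible [M], where the orthogonal factor exists and is
   unique. *)
Definition qr_Q M : 'M[R]_n :=
  xget 1%:M [set Q | orthogonal_mx Q /\
                     exists2 U, pos_upper_mx U & M = Q *m U].

End MatrixClasses.

(* The spectrum is [lam : 'I_m.+2 -> R], so the matrices have size
   n = m.+2 >= 2; the row and column indices n and n-1 of the mathematical
   notation are [ord_max] and [inord m]. *)
Section QRIteration.
Context {R : realType} {m : nat}.
Variable lam : 'I_m.+2 -> R.
Implicit Types (T : 'M[R]_m.+2) (s : R) (pi : 'S_m.+2).

Definition Lambda_perm pi : 'M[R]_m.+2 := diag_mx (\row_i lam (pi i)).

Definition Lambda : 'M[R]_m.+2 := diag_mx (\row_i lam i).

Definition isospectral : set 'M[R]_m.+2 :=
  [set T | [/\ T^T = T, tridiagonal_mx T & similar_in unitmx Lambda T]].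

Definition chart_domain pi : set 'M[R]_m.+2 :=
  [set T | isospectral T /\
           exists Q, [/\ orthogonal_mx Q, LU_positive Q
                       & T = Q^T *m Lambda_perm pi *m Q]].

Definition regular_pairs : set (R * 'M[R]_m.+2) :=
  (~` range lam) `*` isospectral.

Definition qr_step (p : R * 'M[R]_m.+2) : 'M[R]_m.+2 :=
  let Q := qr_Q (p.2 - p.1%:M) in Q^T *m p.2 *m Q.

Definition dom_F : set (R * 'M[R]_m.+2) :=
  regular_pairs `|`
  \bigcup_(i in [set: 'I_m.+2])
    ([set lam i] `*`
     \bigcup_(pi in [set pi : 'S_m.+2 | pi ord_max = i]) chart_domain pi).

(* The continuous extension of [qr_step] from [regular_pairs] to [dom_F]: at an
   eigenvalue shift, the value is the joint limit in (s, T) along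
   [regular_pairs]. *)
Definition F s T : 'M[R]_m.+2 :=
  if s \in codom lam
  then lim (qr_step @ within regular_pairs (nbhs (s, T)))
  else qr_step (s, T).

Definition rayleigh T : R := T ord_max ord_max.

Definition dom_G : set 'M[R]_m.+2 :=
  [set T | isospectral T /\ dom_F (rayleigh T, T)].

Definition G T : 'M[R]_m.+2 := F (rayleigh T) T.

Definition subdiag T : R := T ord_max (inord m).

Definition deflation (eps : R) : set 'M[R]_m.+2 :=
  [set T | isospectral T /\ `|subdiag T| <= eps].

End QRIteration.

(* Main.v *)
Require Import Defs.
From HB Require Import structures.
From mathcomp Require Import all_boot all_order all_fingroup all_algebra.
From mathcomp Require Import mxred.
From mathcomp Require Import all_classical all_reals all_analysis.
From mathcomp Require Import ring lra zify.

(** Write s for the last diagonal entry of T, b for the last subdiagonal entry,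
    e and f for the last and the last but one vector of the standard basis, and
    g > 0 for a lower bound on the distance between two eigenvalues.  Since T is
    tridiagonal, (T - s) e = b f.  So when b is small, e is nearly an eigenvector,
    and it accounts for the only eigenvalue that can be near s; on the orthogonal
    complement of e, T - s is bounded below by about g / 2 ([spectral_gap_bound]).

    Let T - s = Q U be a QR factorization, r the last diagonal entry of U, and q
    the last column of Q.  As T - s is symmetric, it equals U^T Q^T, so
    (T - s) q = r e.  Let w be the part of q orthogonal to e.  The lower bound
    applied to w gives |w| = O(b); the last coordinate of (T - s) q = r e gives
    r = b q_(n-1) = O(b^2).  The new matrix is s + U Q, so its last subdiagonal
    entry is r Q_(n,n-1), and the last factor is at most |w| because the last row
    of Q is a unit vector like its last column.  The product is O(b^3)
    ([cubic_bound]).  With explicit constants, eps = g / 4 and c = 8 / g^2, the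
    bound also gives invariance, since c eps^2 = 1 / 2.

    None of this uses the sign of r.  It applies verbatim when s is an eigenvalue,
    provided T - s = Q U with an upper triangular U whose diagonal is positive
    except possibly in the last place ([qr_pair]); such a factorization exists as
    soon as T - s is injective on the complement of e ([qr_pair_exists]), which
    the lower bound guarantees.  Two points remain for such s.

    The value of F is a limit of QR steps at nearby regular shifts, and has to be
    identified with Q^T T Q ([F_eigenvalue]).  The first n - 1 columns of the
    orthogonal factor are continuous there ([qr_factor_cvg_col]).  The last one is
    continuous up to sign, and that sign only affects entries which vanish in
    the limit, because r = 0 ([conj_cvg]).

    The pair (s, T) has to lie in the domain of F.  If s = lam_i and T = V^T Lam V
    with V orthogonal, the lower bound excludes V_(i,n) = 0: row i of V would be an
    eigenvector for s orthogonal to e.  Hence the minor of V complementary to this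
    entry is invertible, a pivoted LU factorization of that minor orders the other
    rows, and changing signs of rows makes the result LU-positive
    ([lu_positive_reordering]). *)

Set Implicit Arguments.
Unset Strict Implicit.
Unset Printing Implicit Defensive.
Import Order.TTheory GRing.Theory Num.Theory numFieldNormedType.Exports.

Local Open Scope classical_set_scope.
Local Open Scope ring_scope.

Section LinearAlgebra.
Context {R : realType}.

(** * Squared Euclidean norm *)

Definition sqnorm n (x : 'cV[R]_n) : R := \sum_i x i 0 ^+ 2.

Lemma sqnormE n (x : 'cV[R]_n) : sqnorm x = (x^T *m x) 0 0.
Proof. by rewrite mxE; apply: eq_bigr => i _; rewrite mxE expr2. Qed.

Lemma sqnorm_ge0 n (x : 'cV[R]_n) : 0 <= sqnorm x.
Proof. by apply: sumr_ge0 => i _; apply: sqr_ge0. Qed.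

Lemma sqnorm_eq0 n (x : 'cV[R]_n) : (sqnorm x == 0) = (x == 0).
Proof.
apply/idP/eqP => [|->]; last first.
  by rewrite /sqnorm big1 // => i _; rewrite mxE expr0n.
rewrite psumr_eq0 => [/allP h|i _]; last exact: sqr_ge0.
apply/matrixP=> i j; rewrite ord1 mxE; apply/eqP.
by rewrite -sqrf_eq0; apply: (implyP (h i _)); rewrite ?mem_index_enum.
Qed.

Lemma sqnorm_orthogonal n (Q : 'M[R]_n) (x : 'cV[R]_n) :
  orthogonal_mx Q -> sqnorm (Q *m x) = sqnorm x.
Proof.
by move=> h; rewrite !sqnormE trmx_mul mulmxA -(mulmxA _ _ Q) h mulmx1.
Qed.

Lemma sqnormZ n a (x : 'cV[R]_n) : sqnorm (a *: x) = a ^+ 2 * sqnorm x.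
Proof. by rewrite /sqnorm mulr_sumr; apply: eq_bigr => i _; rewrite mxE exprMn. Qed.

Lemma sqnorm_delta n (i : 'I_n) : sqnorm (delta_mx i 0 : 'cV[R]_n) = 1.
Proof.
rewrite /sqnorm (bigD1 i) //= mxE !eqxx expr1n big1 ?addr0 // => j ji.
by rewrite mxE (negbTE ji) expr0n.
Qed.

Lemma trmxZ m n a (A : 'M[R]_(m, n)) : (a *: A)^T = a *: A^T.
Proof. exact: linearZ. Qed.

Lemma sqnormB n (x y : 'cV[R]_n) : x^T *m y = 0 ->
  sqnorm (x - y) = sqnorm x + sqnorm y.
Proof.
move=> xy; have yx : y^T *m x = 0 by rewrite -[LHS]trmxK trmx_mul trmxK xy trmx0.
have trB : (x - y)^T = x^T - y^T by rewrite linearB.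
rewrite !sqnormE trB mulmxBl !mulmxBr xy yx subr0 sub0r opprK.
by rewrite mxE.
Qed.

Lemma ltn_ord_max n (i : 'I_n.+1) : i != ord_max -> (i < @ord_max n)%N.
Proof. by rewrite -val_eqE /= => ni; have := ltn_ord i; lia. Qed.

(** * Spectral decomposition of symmetric matrices with simple spectrum *)

(** The columns of P are eigenvectors of T.  Symmetry makes P^T P commute with
    the diagonal matrix, whose entries are distinct, so P^T P is diagonal and P
    only has to be normalized. *)
Lemma orthogonal_diagonalization n (T P : 'M[R]_n) (lam : 'I_n -> R) :
  T^T = T -> injective lam -> P \in unitmx ->
  P *m diag_mx (\row_i lam i) = T *m P ->
  exists2 V, orthogonal_mx V & T = V^T *m diag_mx (\row_i lam i) *m V.
Proof.
move=> symT injl uP PL; set L := diag_mx _ in PL *.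
have L_sym : L^T = L by rewrite tr_diag_mx.
have comm : P^T *m P *m L = L *m (P^T *m P).
  have -> : L *m (P^T *m P) = (P *m L)^T *m P by rewrite trmx_mul L_sym mulmxA.
  by rewrite -mulmxA PL trmx_mul symT mulmxA.
have offdiag i j : i != j -> (P^T *m P) i j = 0.
  move=> nij; have := congr1 (fun M : 'M[R]_n => M i j) comm.
  rewrite mul_mx_diag mul_diag_mx !mxE => /eqP.
  rewrite mulrC -subr_eq0 -mulrBl mulf_eq0 subr_eq0 => /orP[/eqP/injl eij|/eqP//].
  by rewrite eij eqxx in nij.
pose d i := (P^T *m P) i i.
have d_gt0 i : 0 < d i.
  have -> : d i = sqnorm (col i P).
    by rewrite /d /sqnorm mxE; apply: eq_bigr => k _; rewrite !mxE expr2.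
  rewrite lt_def sqnorm_ge0 andbT sqnorm_eq0 colE; apply/eqP.
  move/(congr1 (mulmx (invmx P))); rewrite mulKmx // mulmx0.
  move=> /matrixP/(_ i 0); rewrite !mxE eqxx => /eqP; rewrite oner_eq0 //.
pose S := diag_mx (\row_i (Num.sqrt (d i))^-1).
have SPP : S *m P^T *m (S *m P^T)^T = 1%:M.
  rewrite trmx_mul trmxK tr_diag_mx !mulmxA -(mulmxA S) mul_mx_diag.
  apply/matrixP => i j; rewrite mxE mul_diag_mx !mxE.
  have [<-|nij] := eqVneq i j; last first.
    by have := offdiag i j nij; rewrite mxE => ->; rewrite mulr0 mul0r.
  under eq_bigr do rewrite mxE; rewrite mulr1n.
  have -> : \sum_k P k i * P k i = d i.
    by rewrite /d mxE; apply: eq_bigr => k _; rewrite mxE.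
  have di : Num.sqrt (d i) != 0 by rewrite gt_eqF // sqrtr_gt0.
  by rewrite -{2}[d i](sqr_sqrtr (ltW (d_gt0 i))); field.
exists (S *m P^T); first exact: mulmx1C.
rewrite -[LHS]mul1mx -(mulmx1C SPP) -!mulmxA; congr (_ *m _).
have -> : P^T *m T = L *m P^T.
  by rewrite -[in LHS]symT -trmx_mul -PL trmx_mul L_sym.
by rewrite !mulmxA diag_mxC.
Qed.

Lemma shifted_spectral n (T V : 'M[R]_n) (lam : 'I_n -> R) s :
  orthogonal_mx V -> T = V^T *m diag_mx (\row_i lam i) *m V ->
  T - s%:M = V^T *m diag_mx (\row_i (lam i - s)) *m V.
Proof.
move=> orthV ->; have -> : \row_i (lam i - s) = \row_i lam i - const_mx s.
  by apply/rowP => i; rewrite !mxE.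
rewrite linearB /= diag_const_mx mulmxBr mulmxBl mul_mx_scalar -scalemxAl.
by rewrite orthV scalemx1.
Qed.

Lemma shifted_unit n (T V : 'M[R]_n) (lam : 'I_n -> R) s :
  orthogonal_mx V -> T = V^T *m diag_mx (\row_i lam i) *m V ->
  (T - s%:M \in unitmx) = [forall i, lam i != s].
Proof.
move=> orthV TE; have [uVT uV] := mulmx1_unit orthV.
rewrite (shifted_spectral s orthV TE) !unitmx_mul uVT uV andbT /=.
rewrite unitmxE det_diag unitfE prodf_seq_neq0.
apply/allP/forallP => h i; first by have := h i (mem_index_enum _); rewrite mxE subr_eq0.
by rewrite mxE subr_eq0 h.
Qed.

(** A lower bound for T - s on the orthogonal complement of an approximate
    eigenvector e.  Only one eigenvalue, of index k say, can be within g / 2 of s.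
    In the plane spanned by w and e some vector has no component along the k-th
    eigenvector; T - s stretches it by at least g / 2, which cannot be if
    both (T - s) w and (T - s) e are small. *)
Lemma spectral_gap_bound n (T V : 'M[R]_n.+1) (lam : 'I_n.+1 -> R) (g s : R)
    (w e : 'cV[R]_n.+1) :
  orthogonal_mx V -> T = V^T *m diag_mx (\row_i lam i) *m V ->
  0 <= g -> (forall i j, i != j -> g <= `|lam i - lam j|) ->
  sqnorm e = 1 -> w^T *m e = 0 ->
  (g ^+ 2 / 4 - sqnorm ((T - s%:M) *m e)) * sqnorm w <=
    sqnorm ((T - s%:M) *m w).
Proof.
move=> orthV TE g0 gap e1 we0; set A := T - s%:M.
have [k hk] : exists k, forall i, i != k -> g / 2 <= `|lam i - s|.
  case: (pickP (fun k => `|lam k - s| < g / 2)) => [k lk | far].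
    exists k => i /gap; have := ler_distD s (lam i) (lam k).
    by rewrite (distrC s); lra.
  by exists ord0 => i _; rewrite leNgt far.
have AE u : A *m u = V^T *m (diag_mx (\row_i (lam i - s)) *m (V *m u)).
  by rewrite /A (shifted_spectral s orthV TE) !mulmxA.
have key u : (V *m u) k 0 = 0 -> g ^+ 2 / 4 * sqnorm u <= sqnorm (A *m u).
  move=> uk; rewrite AE sqnorm_orthogonal; last first.
    by rewrite /orthogonal_mx trmxK; apply: mulmx1C.
  rewrite -(sqnorm_orthogonal u orthV) /sqnorm mulr_sumr; apply: ler_sum => i _.
  rewrite mul_diag_mx !mxE exprMn; have [->|/hk ik] := eqVneq i k.
    by move: uk; rewrite mxE => ->; rewrite expr0n !mulr0.
  apply: ler_wpM2r; first exact: sqr_ge0.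
  by rewrite -[(lam i - s) ^+ 2]real_normK ?num_real //; nra.
(* z w - y e is the vector of the plane without k-th component. *)
set y := (V *m w) k 0; set z := (V *m e) k 0.
have combE (p q : 'cV[R]_n.+1) i :
  (z *: p - y *: q) i 0 = z * p i 0 - y * q i 0 by rewrite !mxE.
have lin : (V *m (z *: w - y *: e)) k 0 = 0.
  by rewrite mulmxBr -!scalemxAr combE -/y -/z mulrC subrr.
have norm_u : sqnorm (z *: w - y *: e) = z ^+ 2 * sqnorm w + y ^+ 2.
  rewrite sqnormB ?sqnormZ ?e1 ?mulr1 //.
  by rewrite -scalemxAr trmxZ -scalemxAl we0 !scaler0.
set N := sqnorm w in norm_u *; set b := sqnorm (A *m e); set a := sqnorm (A *m w).
have N0 : 0 <= N := sqnorm_ge0 w.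
(* For M > 0 this is Cauchy-Schwarz for the pairs (z sqrt M, y) and
   (p / sqrt M, - q) in each coordinate, multiplied by M. *)
have cs (M : R) : M * sqnorm (A *m (z *: w - y *: e)) <=
                  (z ^+ 2 * M + y ^+ 2) * (a + b * M).
  rewrite mulmxBr -!scalemxAr.
  rewrite /a /b /sqnorm mulr_suml -big_split !mulr_sumr /=.
  apply: ler_sum => i _; rewrite combE.
  move: ((A *m w) i 0) ((A *m e) i 0) => p q.
  by have := sqr_ge0 (y * p + z * M * q); lra.
have [npos | pos] := lerP (z ^+ 2 * N + y ^+ 2) 0; last first.
  have := key _ lin; rewrite norm_u => le1.
  rewrite -(ler_pM2l pos).
  by have := ler_wpM2l N0 le1; have := cs N; lra.
(* Otherwise y = 0, so w itself has no k-th component. *)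
have y0 : y = 0.
  apply/eqP; rewrite -sqrf_eq0 eq_le sqr_ge0 andbT.
  by have := mulr_ge0 (sqr_ge0 z) N0; lra.
have := key _ y0; rewrite -/N -/a.
have : 0 <= b * N by rewrite mulr_ge0 ?sqnorm_ge0.
lra.
Qed.

(** * Existence of QR factorizations *)

(** Induction on the size, through the Schur complement S of the first diagonal
    entry: S is positive definite because x^T S x is the value of the form of A
    at the vector extending x that annihilates the first row of A. *)
Lemma cholesky n (A : 'M[R]_n) :
  A^T = A -> (forall x : 'cV_n, x != 0 -> 0 < (x^T *m A *m x) 0 0) ->
  exists2 U, pos_upper_mx U & A = U^T *m U.
Proof.
elim: n => [|n IHn] in A *.
  by move=> _ _; exists 1%:M; [split=> [|[]//]; apply/is_trig_mxP=> -[] | apply/matrixP=> -[]].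
rewrite -[n.+1]/(1 + n)%N in A *; move=> symA posA.
set b := ursubmx A; set D := drsubmx A; set al := A 0 0.
have AE : A = block_mx al%:M b b^T D.
  rewrite -[LHS]submxK [ulsubmx _]mx11_scalar; congr (block_mx _%:M _ _ _).
    by rewrite !mxE /al; congr (A _ _); apply: val_inj.
  by rewrite -[in LHS]symA -trmx_ursub.
have symD : D^T = D by rewrite /D trmx_drsub symA.
have al_gt0 : 0 < al.
  have := posA (delta_mx 0 0).
  rewrite trmx_delta -rowE -colE !mxE; apply.
  by apply/eqP => /matrixP/(_ 0 0); rewrite !mxE eqxx => /eqP; rewrite oner_eq0.
have al_neq0 : al != 0 by rewrite gt_eqF.
set S := D - al^-1 *: (b^T *m b).
have symS : S^T = S.
  by rewrite /S linearB linearZ /= trmx_mul trmxK symD.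
have posS (x : 'cV_n) : x != 0 -> 0 < (x^T *m S *m x) 0 0.
  move=> x0; pose y := col_mx (- al^-1 *: (b *m x)) x.
  have /posA : y != 0.
    apply: contraNneq x0 => y0.
    by rewrite -[x](col_mxKd (- al^-1 *: (b *m x))) -/y y0 raddf0.
  rewrite -mulmxA {1}AE mul_block_col mul_scalar_mx scalerA mulrN mulfV // scaleN1r.
  rewrite addNr tr_col_mx mul_row_col mulmx0 add0r -scalemxAr scaleNr addrC.
  by rewrite mulmxA scalemxAl -mulmxBl -/S mulmxA.
have [U [trigU posU] SE] := IHn S symS posS.
set r := Num.sqrt al; have r_gt0 : 0 < r by rewrite sqrtr_gt0.
have rr : r * r = al by rewrite -expr2 sqr_sqrtr // ltW.
exists (block_mx r%:M (r^-1 *: b) 0 U).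
  split.
    rewrite tr_block_mx is_trig_block_mx // trmx0 eqxx trigU andbT /=.
    by rewrite tr_scalar_mx; apply/is_trig_mxP => i j; rewrite !ord1.
  move=> i; case: (split_ordP i) => j ->.
    by rewrite block_mxEul ord1 mxE eqxx.
  by rewrite block_mxEdr.
rewrite AE tr_block_mx mulmx_block !mulmx0 !trmx0 !mul0mx !addr0 tr_scalar_mx.
have -> : (r^-1 *: b)^T = r^-1 *: b^T by rewrite linearZ.
rewrite !mul_scalar_mx mul_mx_scalar scale_scalar_mx rr !scalerA.
rewrite mulfV ?gt_eqF // !scale1r; congr block_mx.
rewrite -SE -scalemxAl -scalemxAr scalerA -invfM rr addrC.
by rewrite /S subrK.
Qed.

(** U is the Cholesky factor of M^T M, and Q = M U^-1 is then orthogonal. *)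
Lemma qr_exists n (M : 'M[R]_n) : M \in unitmx ->
  exists Q U, [/\ orthogonal_mx Q, pos_upper_mx U & M = Q *m U].
Proof.
move=> uM; have [||U pU UE] := @cholesky _ (M^T *m M).
- by rewrite trmx_mul trmxK.
- move=> x x0; rewrite mulmxA -trmx_mul -mulmxA -sqnormE lt_def sqnorm_ge0 andbT.
  by rewrite sqnorm_eq0; apply: contraNneq x0 => Mx0; rewrite -(mulKmx uM x) Mx0 mulmx0.
have uU : U \in unitmx.
  by have := uM; rewrite -[M \in _]andbb -{1}unitmx_tr -unitmx_mul UE unitmx_mul => /andP[].
exists (M *m invmx U), U; split=> //; last by rewrite mulmxKV.
rewrite /orthogonal_mx trmx_mul -!mulmxA [M^T *m _]mulmxA UE -!mulmxA mulmxV // mulmx1.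
by rewrite -trmx_mul mulmxV // trmx1.
Qed.

Lemma unitmx_col_inj n (M : 'M[R]_n) :
  (forall x : 'cV_n, M *m x = 0 -> x = 0) -> M \in unitmx.
Proof.
move=> inj; rewrite -unitmx_tr -row_free_unit -kermx_eq0; apply/rowV0P => v.
move=> /sub_kermxP vM; apply: trmx_inj; rewrite trmx0; apply: inj.
by rewrite -[LHS]trmxK trmx_mul trmxK vM trmx0.
Qed.

(** A QR factorization without condition on the last diagonal entry of U.  This
    is what survives when M becomes singular but the columns before the last stay
    independent. *)
Definition qr_pair n (M Q U : 'M[R]_n.+1) : Prop :=
  [/\ orthogonal_mx Q, is_trig_mx U^T, forall i, i != ord_max -> 0 < U i i
    & M = Q *m U].

(** The columns of Q and U before the last depend only on those of M.  So the last column of M can be altered to make M invertible: it suffices to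
    add to it a vector v orthogonal to the range of M. *)
Lemma qr_pair_exists n (M : 'M[R]_n.+1) :
  (forall x : 'cV_n.+1, x ord_max 0 = 0 -> M *m x = 0 -> x = 0) ->
  exists Q U, qr_pair M Q U.
Proof.
move=> inj.
have [M' uM' MM'] : exists2 M' : 'M[R]_n.+1, M' \in unitmx &
    forall i j, j != ord_max -> M' i j = M i j.
  have [uM|] := boolP (M \in unitmx); first by exists M.
  rewrite -row_free_unit -kermx_eq0 => /rowV0Pn[v /sub_kermxP vM v0].
  exists (M + v^T *m delta_mx 0 ord_max); last first.
    move=> i j nj; rewrite !mxE big_ord1 !mxE eqxx (negbTE nj) /=.
    by rewrite mulr0 addr0.
  apply: unitmx_col_inj => x.
  rewrite mulmxDl -mulmxA -rowE => Mx.
  have vv : v *m v^T *m row ord_max x = 0.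
    by have := congr1 (mulmx v) Mx; rewrite mulmxDr !mulmxA vM mul0mx add0r mulmx0.
  have xn : x ord_max 0 = 0.
    move: vv => /matrixP/(_ 0 0); rewrite !mxE big_ord1 !mxE => /eqP.
    rewrite mulf_eq0 => /orP[|/eqP//].
    have -> : \sum_j v 0 j * v^T j 0 = sqnorm v^T.
      by apply: eq_bigr => i _; rewrite mxE expr2.
    by rewrite sqnorm_eq0 trmx_eq0 (negbTE v0).
  apply: inj => //; move: Mx; rewrite (_ : row _ _ = 0) ?mulmx0 ?addr0 //.
  by apply/rowP => i; rewrite ord1 !mxE.
have [Q [U [orthQ [trigU posU] M'E]]] := qr_exists uM'.
exists Q, (Q^T *m M); split=> //; last by rewrite mulmxA (mulmx1C orthQ) mul1mx.
- have col_eq i j : j != ord_max -> (Q^T *m M) i j = U i j.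
    move=> nj; rewrite -[U]mul1mx -orthQ -mulmxA -M'E !mxE.
    by apply: eq_bigr => k _; rewrite MM'.
  apply/is_trig_mxP => i j ij; rewrite mxE col_eq.
    by have /is_trig_mxP/(_ i j ij) := trigU; rewrite mxE.
  by apply/eqP => ie; have := leq_ord j; rewrite leqNgt -/(n < _)%N; rewrite ie in ij; rewrite ij.
- move=> i ni; rewrite (_ : (_ *m M) i i = U i i) //.
  rewrite -[U]mul1mx -orthQ -mulmxA -M'E !mxE.
  by apply: eq_bigr => k _; rewrite MM'.
Qed.

(** * Conjugation by the orthogonal factor *)

Lemma qr_pair_conjE n (T Q U : 'M[R]_n.+1) s : qr_pair (T - s%:M) Q U ->
  Q^T *m T *m Q = s%:M + U *m Q.
Proof.
move=> [orthQ _ _ QU]; rewrite -[T](subrK s%:M) QU mulmxDr mulmxDl !mulmxA orthQ.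
by rewrite mul1mx addrC mul_mx_scalar -scalemxAl orthQ scalemx1.
Qed.

(** T' = Q^T T Q satisfies T' U = U T, which is upper Hessenberg.  Dividing by U
    column by column, T' is Hessenberg too, hence tridiagonal by symmetry.  The
    last column of a Hessenberg matrix carries no condition, so the last diagonal
    entry of U is never divided by. *)
Lemma qr_pair_tridiagonal n (T Q U : 'M[R]_n.+1) s :
  T^T = T -> tridiagonal_mx T -> qr_pair (T - s%:M) Q U ->
  tridiagonal_mx (Q^T *m T *m Q).
Proof.
move=> symT triT [orthQ /is_trig_mxP trigU posU TE].
have upU (i j : 'I_n.+1) : (j < i)%N -> U i j = 0 by move=> /trigU; rewrite mxE.
set T' := Q^T *m T *m Q.
have symT' : T'^T = T' by rewrite /T' !trmx_mul trmxK symT mulmxA.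
have UE : U = Q^T *m (T - s%:M) by rewrite TE mulmxA orthQ mul1mx.
have comm : T' *m U = U *m T.
  rewrite /T' -!mulmxA -TE UE -mulmxA; congr (_ *m _).
  by rewrite mulmxBr mulmxBl scalar_mxC.
have hess k (i j : 'I_n.+1) : (j < k)%N -> (j.+1 < i)%N -> T' i j = 0.
  elim: k => // k IH in i j *; rewrite ltnS => jk ji.
  have : (T' *m U) i j = 0.
    rewrite comm mxE big1 // => l _; have [li|il] := ltnP l i.
      by rewrite upU ?mul0r.
    by rewrite triT ?mulr0 //; apply/orP; right; apply: leq_trans il.
  rewrite mxE (bigD1 j) //= big1 => [|l lj].
    rewrite addr0 => /eqP; rewrite mulf_eq0 => /orP[/eqP//|].
    rewrite gt_eqF // posU // -val_eqE /= neq_ltn.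
    by have := ltn_ord i; lia.
  have [l_lt|j_lt|/val_inj ljE] := ltngtP l j; last by rewrite ljE eqxx in lj.
    by rewrite IH ?mul0r //; lia.
  by rewrite upU ?mulr0.
move=> i j /orP[ij|ij]; last exact: (hess j.+1).
by rewrite -symT' mxE; apply: (hess i.+1).
Qed.

(** * One Rayleigh-shifted step near deflation *)

Section Deflation.
Variables (m : nat) (T V : 'M[R]_m.+2) (lam : 'I_m.+2 -> R) (g : R).
Hypotheses (symT : T^T = T) (triT : tridiagonal_mx T)
  (orthV : orthogonal_mx V) (TE : T = V^T *m diag_mx (\row_i lam i) *m V)
  (g_gt0 : 0 < g) (gap : forall i j, i != j -> g <= `|lam i - lam j|)
  (small : `|subdiag T| <= g / 4).
Let b := subdiag T.
Let s := rayleigh T.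
Let e : 'cV[R]_m.+2 := delta_mx ord_max 0.
Let f : 'cV[R]_m.+2 := delta_mx (inord m) 0.

Lemma shifted_last_col : (T - s%:M) *m e = b *: f.
Proof.
apply/colP => i; rewrite -colE /f !mxE eqxx andbT.
rewrite -[i == inord m]val_eqE /= inordK //.
have [->|ni] := eqVneq i ord_max.
  rewrite mulr1n /s /rayleigh subrr /=.
  by rewrite (_ : m.+1 == m = false) ?mulr0 //; apply/negbTE; lia.
rewrite mulr0n subr0; have [im|im] := eqVneq (i : nat) m.
  rewrite mulr1 -symT mxE /b /subdiag; congr (T _ _).
  by apply: val_inj; rewrite /= inordK.
rewrite mulr0; apply: triT; apply/orP; left => /=.
move: ni im; rewrite -val_eqE /= => ni im; have := ltn_ord i; lia.
Qed.

Lemma subdiag_sqr_small : b ^+ 2 <= g ^+ 2 / 16.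
Proof. by move: small; rewrite -/b ler_norml => /andP[]; nra. Qed.

Lemma deflated_gap (x : 'cV[R]_m.+2) : x ord_max 0 = 0 ->
  (g ^+ 2 / 4 - b ^+ 2) * sqnorm x <= sqnorm ((T - s%:M) *m x).
Proof.
move=> xn; have := spectral_gap_bound (w := x) (e := e) s orthV TE (ltW g_gt0) gap.
rewrite shifted_last_col sqnormZ !sqnorm_delta mulr1; apply=> //.
by rewrite -colE; apply/colP => i; rewrite ord1 !mxE.
Qed.

(** The hypothesis of [qr_pair_exists] for T - s. *)
Lemma deflated_inj (x : 'cV[R]_m.+2) : x ord_max 0 = 0 ->
  (T - s%:M) *m x = 0 -> x = 0.
Proof.
move=> /deflated_gap + Tx; rewrite Tx => le; apply/eqP; rewrite -sqnorm_eq0.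
have s0 : sqnorm (0 : 'cV[R]_m.+2) = 0 by apply/eqP; rewrite sqnorm_eq0.
rewrite s0 in le; have := subdiag_sqr_small; have := sqnorm_ge0 x; rewrite eq_le => x0 b2.
by rewrite x0 andbT; have : 0 < g ^+ 2 by [rewrite exprn_gt0]; nra.
Qed.

Lemma cubic_bound Q U : qr_pair (T - s%:M) Q U ->
  `|subdiag (Q^T *m T *m Q)| <= 8 / g ^+ 2 * `|b| ^+ 3.
Proof.
move=> qrT; have [orthQ /is_trig_mxP trigU posU QU] := qrT.
have symA : (T - s%:M)^T = T - s%:M by rewrite linearB /= tr_scalar_mx symT.
set r := U ord_max ord_max; set q := col ord_max Q.
have Aq : (T - s%:M) *m q = r *: e.
  have AQ : (T - s%:M) *m Q = U^T.
    by rewrite -symA QU trmx_mul -mulmxA orthQ mulmx1.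
  rewrite /q colE mulmxA AQ -colE; apply/colP => i; rewrite !mxE eqxx andbT.
  have [->|ni] := eqVneq i ord_max; first by rewrite mulr1.
  have := trigU i ord_max; rewrite mxE mulr0; apply.
  exact: ltn_ord_max.
have rE : r = b * q (inord m) 0.
  transitivity ((e^T *m ((T - s%:M) *m q)) 0 0).
    by rewrite Aq trmx_delta -rowE !mxE !eqxx mulr1.
  rewrite -[T - _]symA mulmxA -trmx_mul shifted_last_col linearZ /= -scalemxAl.
  by rewrite trmx_delta -rowE !mxE.
have q1 : sqnorm q = 1 by rewrite /q colE sqnorm_orthogonal // sqnorm_delta.
set z := q ord_max 0; pose w := q - z *: e; set N := sqnorm w.
have subE (p : 'cV[R]_m.+2) i : (p - z *: e) i 0 = p i 0 - z * (i == ord_max)%:R.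
  by rewrite !mxE andbT.
have wE i : i != ord_max -> w i 0 = q i 0.
  by move=> ni; rewrite subE (negbTE ni) mulr0 subr0.
have wn : w ord_max 0 = 0 by rewrite subE eqxx mulr1 subrr.
(* w is the part of the unit vector q orthogonal to e. *)
have NE : N = 1 - z ^+ 2.
  rewrite -q1 /N /sqnorm [in LHS](bigD1 ord_max) // [in RHS](bigD1 ord_max) //=.
  by rewrite wn -/z expr0n add0r addrAC subrr add0r; apply: eq_bigr => i /wE->.
have r2 : r ^+ 2 <= b ^+ 2 * N.
  rewrite rE exprMn ler_wpM2l ?sqr_ge0 // -wE; last first.
    by rewrite -val_eqE /= inordK //; lia.
  by rewrite /N /sqnorm (bigD1 (inord m)) //= lerDl sumr_ge0 // => i _; apply: sqr_ge0.
(* The lower bound applied to w, where (T - s) w = r e - z b f. *)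
have N_small : g ^+ 2 / 8 * N <= b ^+ 2.
  have := deflated_gap wn; rewrite -/N mulmxBr Aq -scalemxAr shifted_last_col.
  have -> : sqnorm (r *: e - z *: (b *: f)) = r ^+ 2 + (z * b) ^+ 2.
    rewrite sqnormB ?sqnormZ ?sqnorm_delta ?mulr1 ?exprMn //.
    rewrite trmxZ -scalemxAl trmx_delta -rowE.
    rewrite (_ : row _ _ = 0) ?scaler0 //; apply/rowP => i.
    rewrite !mxE -val_eqE /= inordK // (_ : m.+1 == m = false) ?mulr0 //.
    by apply/negbTE; lia.
  have := subdiag_sqr_small; have := sqnorm_ge0 w; rewrite -/N => N0 b16 le.
  have bN : b ^+ 2 * N <= g ^+ 2 / 16 * N by apply: ler_wpM2r.
  have : (z * b) ^+ 2 <= b ^+ 2.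
    by rewrite exprMn ler_piMl ?sqr_ge0 //; lra.
  lra.
have T'E : subdiag (Q^T *m T *m Q) = r * Q ord_max (inord m).
  rewrite (qr_pair_conjE qrT) /subdiag !mxE (bigD1 ord_max) //= big1 ?addr0 => [|j nj].
    by rewrite -val_eqE /= inordK // (_ : m.+1 == m = false) ?add0r //; apply/negbTE; lia.
  have := trigU j ord_max; rewrite mxE => -> //; first by rewrite mul0r.
  exact: ltn_ord_max.
(* The last row of Q is a unit vector whose last coordinate is z, too. *)
have Q2 : Q ord_max (inord m) ^+ 2 <= N.
  have : (Q *m Q^T) ord_max ord_max = 1 by rewrite (mulmx1C orthQ) mxE eqxx.
  rewrite mxE (bigD1 ord_max) //= (bigD1 (inord m)) /=; last first.
    by rewrite -val_eqE /= inordK //; lia.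
  have : 0 <= \sum_(i | (i != ord_max) && (i != inord m)) Q ord_max i * Q^T i ord_max.
    by apply: sumr_ge0 => i _; rewrite mxE -expr2 sqr_ge0.
  rewrite NE /z !mxE !expr2; lra.
have T'2 : subdiag (Q^T *m T *m Q) ^+ 2 <= (b * N) ^+ 2.
  rewrite T'E exprMn (_ : (b * N) ^+ 2 = b ^+ 2 * N * N); last by ring.
  by apply: ler_pM; rewrite ?sqr_ge0.
have : `|subdiag (Q^T *m T *m Q)| <= `|b| * N.
  rewrite -[N]ger0_norm ?sqnorm_ge0 // -normrM -ler_sqr ?nnegrE //.
  by rewrite !real_normK ?num_real.
move=> /le_trans; apply; rewrite (exprS `|b|) mulrCA ler_wpM2l // real_normK ?num_real //.
rewrite mulrAC ler_pdivlMr ?exprn_gt0 //; lra.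
Qed.

End Deflation.

(** * LU-positive reorderings of an orthogonal matrix *)

Lemma lu_pivoted n (A : 'M[R]_n.+1) :
  exists (p : 'S_n.+1) L U, [/\ unit_lower_mx L, is_trig_mx U^T & row_perm p A = L *m U].
Proof.
have := cormen_lup_correct A; have := cormen_lup_perm A.
have := cormen_lup_lower A; have := cormen_lup_upper A.
case: (cormen_lup A) => [[P L] U] /= upU lowL /is_perm_mxP[p ->] LU.
exists p, L, U; split; last by rewrite row_permE.
  split=> [|i]; last by rewrite (lowL i i (leqnn i)) eqxx.
  apply/is_trig_mxP => i j ij; rewrite (lowL i j (ltnW ij)).
  by rewrite -val_eqE /= (ltn_eqF ij).
by apply/is_trig_mxP => i j ij; rewrite mxE (upU _ _ ij).
Qed.

(** An LU factorization of a bordered matrix: the new row and column are obtained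
    by solving against the invertible factors, and the corner by subtraction. *)
Lemma lu_border n (M : 'M[R]_n.+1) (L U : 'M[R]_n) :
  unit_lower_mx L -> is_trig_mx U^T -> U \in unitmx ->
  row' ord_max (col' ord_max M) = L *m U ->
  exists L' U', [/\ unit_lower_mx L', is_trig_mx U'^T & M = L' *m U'].
Proof.
move=> [trigL diagL] trigU uU MLU.
have uL : L \in unitmx.
  by rewrite unitmxE det_trig // big1 ?unitr1 // => i _; rewrite diagL.
pose c := row ord_max (col' ord_max M) *m invmx U.
pose d := invmx L *m col ord_max (row' ord_max M).
pose L' : 'M[R]_n.+1 := \matrix_(i, j)
  match unlift ord_max i, unlift ord_max j with
  | Some i', Some j' => L i' j' | None, Some j' => c 0 j'
  | None, None => 1 | Some _, None => 0 end.
pose U' : 'M[R]_n.+1 := \matrix_(i, j)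
  match unlift ord_max i, unlift ord_max j with
  | Some i', Some j' => U i' j' | Some i', None => d i' 0
  | None, None => M ord_max ord_max - (c *m d) 0 0 | None, Some _ => 0 end.
have max_lt (i : 'I_n) : (lift ord_max i < @ord_max n)%N by rewrite lift_max ltn_ord.
exists L', U'; split.
- split=> [|i]; last by rewrite mxE; case: unliftP => [i' _|_] //; rewrite diagL.
  apply/is_trig_mxP => i j; rewrite mxE.
  case: unliftP => [i'|] ->; case: unliftP => [j'|] -> //.
  - by rewrite !lift_max; move/is_trig_mxP: trigL; apply.
  - by rewrite ltnNge ltnW.
  - by rewrite ltnn.
- apply/is_trig_mxP => i j; rewrite !mxE.
  case: unliftP => [i'|] ->; case: unliftP => [j'|] -> //.
  - by rewrite !lift_max => ij; have /is_trig_mxP/(_ _ _ ij) := trigU; rewrite mxE.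
  - by rewrite ltnNge ltnW.
  - by rewrite ltnn.
apply/matrixP => i j; rewrite mxE big_ord_recr /=.
have widenE k : widen_ord (leqnSn n) k = lift ord_max k.
  by apply: val_inj; rewrite /= /bump leqNgt ltn_ord.
under eq_bigr do rewrite widenE !mxE liftK; rewrite !mxE unlift_none.
case: unliftP => [i'|] ->; case: unliftP => [j'|] ->.
- by rewrite mul0r addr0; have /matrixP/(_ i' j') := MLU; rewrite !mxE.
- rewrite mul0r addr0; transitivity ((L *m d) i' 0); last by rewrite mxE.
  by rewrite mulKVmx // !mxE.
- rewrite mulr0 addr0; transitivity ((c *m U) 0 j'); last by rewrite mxE.
  by rewrite mulmxKV // !mxE.
- by rewrite mul1r addrC subrK.
Qed.

(** With E the diagonal matrix of the signs of the diagonal of U, E M is the product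
    of E L E and E U. *)
Lemma lu_sign n (M L U : 'M[R]_n) :
  M \in unitmx -> unit_lower_mx L -> is_trig_mx U^T -> M = L *m U ->
  exists2 d : 'I_n -> R, forall i, d i * d i = 1
   & LU_positive (diag_mx (\row_i d i) *m M).
Proof.
move=> uM [trigL diagL] trigU MLU.
have U_neq0 i : U i i != 0.
  have : U \in unitmx by move: uM; rewrite MLU unitmx_mul => /andP[].
  rewrite -unitmx_tr unitmxE det_trig // unitfE => /prodf_neq0/(_ i isT).
  by rewrite mxE.
pose d i := Num.sg (U i i).
have dd i : d i * d i = 1 by rewrite -expr2 sqr_sg U_neq0.
exists d => //.
set E := diag_mx _.
have EE : E *m E = 1%:M.
  by apply/matrixP => i j; rewrite mul_diag_mx !mxE mulrnAr dd.
exists (E *m L *m E), (E *m U); split.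
- split=> [|i]; last by rewrite mul_mx_diag mul_diag_mx !mxE diagL mulr1 dd.
  apply/is_trig_mxP => i j ij; rewrite mul_mx_diag mul_diag_mx !mxE.
  by have /is_trig_mxP -> // := trigL; rewrite mulr0 mul0r.
- split=> [|i]; last by rewrite mul_diag_mx !mxE /d -normrEsg normr_gt0.
  apply/is_trig_mxP => i j ij; rewrite mul_diag_mx !mxE.
  by have /is_trig_mxP/(_ _ _ ij) := trigU; rewrite mxE => ->; rewrite mulr0.
by rewrite MLU !mulmxA -(mulmxA (E *m L) E E) EE mulmx1.
Qed.

(** For orthogonal V the adjugate is det V times the transpose, so each entry of V is
    the complementary minor up to sign. *)
Lemma orthogonal_minor n (V : 'M[R]_n.+1) i j : orthogonal_mx V ->
  V i j != 0 -> row' i (col' j V) \in unitmx.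
Proof.
move=> orthV Vij; rewrite unitmxE unitfE.
have uV : V \in unitmx by have [] := mulmx1_unit orthV.
have adjE : \adj V = \det V *: V^T.
  by rewrite -[LHS]mul1mx -orthV -mulmxA mul_mx_adj mul_mx_scalar.
have := congr1 (fun M : 'M[R]_n.+1 => M j i) adjE; rewrite !mxE /cofactor => cofE.
have : \det V * V i j != 0 by rewrite mulf_neq0 // -unitfE -unitmxE.
by rewrite -cofE mulf_eq0 negb_or => /andP[].
Qed.

(** Row i of V is moved to the last place, so that the pivoting takes place among
    the other rows only. *)
Lemma lu_positive_reordering n (V : 'M[R]_n.+2) (lam : 'I_n.+2 -> R) i :
  orthogonal_mx V -> V i ord_max != 0 ->
  exists (pi : 'S_n.+2) (Q : 'M[R]_n.+2),
    [/\ pi ord_max = i, orthogonal_mx Q, LU_positive Q &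
     V^T *m diag_mx (\row_k lam k) *m V = Q^T *m diag_mx (\row_k lam (pi k)) *m Q].
Proof.
move=> orthV Vin; have uA := orthogonal_minor orthV Vin.
have [p [L [U [lowL upU ALU]]]] := lu_pivoted (row' i (col' ord_max V)).
pose pi := lift_perm ord_max i p; pose M := row_perm pi V.
have MLU : row' ord_max (col' ord_max M) = L *m U.
  by rewrite -ALU; apply/matrixP => a b; rewrite !mxE lift_perm_lift.
have uU : U \in unitmx.
  have : row_perm p (row' i (col' ord_max V)) \in unitmx.
    by rewrite row_permE unitmx_mul unitmx_perm.
  by rewrite ALU unitmx_mul => /andP[].
have [L' [U' [lowL' upU' ME]]] := lu_border lowL upU uU MLU.
have uV : V \in unitmx by have [] := mulmx1_unit orthV.
have uM : M \in unitmx by rewrite /M row_permE unitmx_mul unitmx_perm.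
have [d dd posQ] := lu_sign uM lowL' upU' ME.
(* The signs d_k cancel and the permutation reindexes the sum over rows. *)
have QE : forall mu : 'I_n.+2 -> R,
    let Q := diag_mx (\row_k d k) *m M in
    V^T *m diag_mx (\row_k mu k) *m V = Q^T *m diag_mx (\row_k mu (pi k)) *m Q.
  have entry (mu : 'I_n.+2 -> R) (W : 'M[R]_n.+2) a b :
      (W^T *m diag_mx (\row_k mu k) *m W) a b = \sum_k W k a * W k b * mu k.
    by rewrite mul_mx_diag mxE; apply: eq_bigr => k _; rewrite !mxE mulrAC.
  move=> mu /=; apply/matrixP => a b; rewrite !entry (reindex_perm pi) /=.
  apply: eq_bigr => k _; rewrite mul_diag_mx !mxE [d k * _ * _]mulrACA dd.
  by rewrite mul1r.
exists pi, (diag_mx (\row_k d k) *m M); split=> //.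
- exact: lift_perm_id.
- have diag1 : diag_mx (\row__ 1) = 1%:M :> 'M[R]_n.+2.
    by rewrite -diag_const_mx; congr diag_mx; apply/rowP => k; rewrite !mxE.
  by rewrite /orthogonal_mx; have /= := QE (fun=> 1); rewrite diag1 !mulmx1 orthV => <-.
Qed.

End LinearAlgebra.

(** * Continuity of the orthogonal factor *)

Section Limits.
Context {R : realType} {X : Type} (Phi : set_system X) {PhiF : Filter Phi}.

Lemma cvg_eqfun (f g : X -> R) (l : R) :
  (forall x, f x = g x) -> g x @[x --> Phi] --> l -> f x @[x --> Phi] --> l.
Proof. by move=> /funext->. Qed.

Lemma cvg_sum_entries (I : finType) (P : pred I) (f : I -> X -> R) (l : I -> R) :
  (forall i, P i -> f i x @[x --> Phi] --> l i) ->
  \sum_(i | P i) f i x @[x --> Phi] --> \sum_(i | P i) l i.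
Proof. by move=> fl; apply: cvg_big => //; exact: add_continuous. Qed.

Lemma cvg_mulmx_entries n p q (A : X -> 'M[R]_(n, p)) (B : X -> 'M[R]_(p, q))
    (A0 : 'M[R]_(n, p)) (B0 : 'M[R]_(p, q)) :
  (forall i j, A x i j @[x --> Phi] --> A0 i j) ->
  (forall i j, B x i j @[x --> Phi] --> B0 i j) ->
  forall i j, (A x *m B x) i j @[x --> Phi] --> (A0 *m B0) i j.
Proof.
move=> AA BB i j; rewrite mxE; under eq_cvg do rewrite mxE.
by apply: cvg_sum_entries => k _; apply: cvgM.
Qed.

Lemma cvg_mx_entries n p (A : X -> 'M[R]_(n, p)) (A0 : 'M[R]_(n, p)) :
  (forall i j, A x i j @[x --> Phi] --> A0 i j) -> A x @[x --> Phi] --> A0.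
Proof.
move=> AA B [P nP PB]; rewrite /= nbhs_simpl.
have : \forall x \near Phi, forall ij : 'I_n * 'I_p, P ij.1 ij.2 (A x ij.1 ij.2).
  by apply: filter_forall => -[i j] /=; exact: (AA i j _ (nP i j)).
by apply: filterS => x Px; apply: PB => i j; exact: (Px (i, j)).
Qed.

Lemma cvg_norm_of_sqr (f : X -> R) (l : R) :
  f x ^+ 2 @[x --> Phi] --> l ^+ 2 -> `|f x| @[x --> Phi] --> `|l|.
Proof.
move=> ff; rewrite -sqrtr_sqr; under eq_cvg do rewrite -sqrtr_sqr.
exact: (continuous_cvg _ (@sqrt_continuous R _) ff).
Qed.

(** W x stands for Q0^T Q x, where M x = Q x U x tends to M0 = Q0 U0. *)
Variable n : nat.
Variables (W U : X -> 'M[R]_n.+1) (U0 : 'M[R]_n.+1).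
Hypotheses (orthW : forall x, orthogonal_mx (W x))
  (posU : forall x, pos_upper_mx (U x))
  (upU0 : is_trig_mx U0^T) (posU0 : forall i, i != ord_max -> 0 < U0 i i)
  (WU : forall i j, (W x *m U x) i j @[x --> Phi] --> U0 i j).

(** Gram-Schmidt is continuous as long as no pivot vanishes in the limit: once the
    first columns of W converge, so do the entries of U above the diagonal in
    column j, hence U_jj times column j of W, hence U_jj as the norm of that
    vector, and U_jj > 0 in the limit. *)
Lemma qr_factor_cvg_col i j : j != ord_max -> W x i j @[x --> Phi] --> ((i == j)%:R : R).
Proof.
have [k] := ubnP (j : nat); elim: k => // k IH in i j *; rewrite ltnS => jk nj.
have Wl (l : 'I_n.+1) i' : (l < j)%N -> W x i' l @[x --> Phi] --> ((i' == l)%:R : R).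
  move=> lj; apply: IH; first exact: leq_trans lj jk.
  by rewrite -val_eqE /= neq_ltn; have := ltn_ord j; lia.
have UE x l : U x l j = \sum_(i' < n.+1) W x i' l * (W x *m U x) i' j.
  have := congr1 (fun M : 'M[R]_n.+1 => (M *m U x) l j) (orthW x).
  rewrite mul1mx -mulmxA => <-; rewrite mxE.
  by apply: eq_bigr => i' _; rewrite mxE.
have Ul (l : 'I_n.+1) : (l < j)%N -> U x l j @[x --> Phi] --> U0 l j.
  move=> lj; under eq_cvg do rewrite UE.
  have -> : U0 l j = \sum_(i' < n.+1) (i' == l)%:R * U0 i' j.
    rewrite (bigD1 l) //= eqxx mul1r big1 ?addr0 // => i' /negbTE->.
    by rewrite mul0r.
  by apply: cvg_sum_entries => i' _; apply: cvgM; [exact: Wl | exact: WU].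
(* Column j of W before normalization. *)
pose Z x i' := W x i' j * U x j j.
have ZE x i' : Z x i' = (W x *m U x) i' j - \sum_(l < n.+1 | (l < j)%N) W x i' l * U x l j.
  rewrite mxE (bigID (fun l : 'I_n.+1 => (l < j)%N)) /= addrC addrK.
  rewrite (bigD1 j) ?ltnn //= big1 ?addr0 // => l /andP[].
  rewrite -leqNgt leq_eqVlt => /orP[/eqP/val_inj->|jl _]; first by rewrite eqxx.
  by have [/is_trig_mxP/(_ _ _ jl)] := posU x; rewrite mxE => ->; rewrite mulr0.
have Zl i' : Z x i' @[x --> Phi] --> (i' == j)%:R * U0 j j.
  under eq_cvg do rewrite ZE.
  have -> : (i' == j)%:R * U0 j j =
            U0 i' j - \sum_(l < n.+1 | (l < j)%N) (i' == l)%:R * U0 l j.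
    have lowU0 (l : 'I_n.+1) : (j < l)%N -> U0 l j = 0.
      by move=> jl; have /is_trig_mxP/(_ _ _ jl) := upU0; rewrite mxE.
    have [i'j | ji' | /val_inj ->] := ltngtP i' j.
    - rewrite (bigD1 i') //= eqxx mul1r big1 => [|l /andP[_ li']].
        by rewrite addr0 subrr -val_eqE /= ltn_eqF // mul0r.
      by rewrite eq_sym (negbTE li') mul0r.
    - rewrite (lowU0 _ ji') sub0r big1 => [|l lj].
        by rewrite oppr0 -val_eqE /= gtn_eqF // mul0r.
      by rewrite -val_eqE /= gtn_eqF ?mul0r // (leq_trans lj) // ltnW.
    - rewrite eqxx mul1r big1 ?subr0 // => l lj.
      by rewrite -val_eqE /= gtn_eqF ?mul0r.
  apply: cvgB; first exact: WU.
  by apply: cvg_sum_entries => l lj; apply: cvgM; [exact: Wl | exact: Ul].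
have Ujj x : U x j j ^+ 2 = \sum_(i' < n.+1) Z x i' ^+ 2.
  transitivity (((W x)^T *m W x) j j * U x j j ^+ 2).
    by rewrite orthW mxE eqxx mul1r.
  rewrite mxE mulr_suml; apply: eq_bigr => l _.
  by rewrite mxE /Z exprMn expr2.
have Uj : U x j j @[x --> Phi] --> U0 j j.
  rewrite -[U0 j j]gtr0_norm ?posU0 //.
  under eq_cvg => x do rewrite -[U x j j]gtr0_norm ?(posU x).2 //.
  apply: cvg_norm_of_sqr; under eq_cvg do rewrite Ujj.
  have -> : U0 j j ^+ 2 = \sum_(i' < n.+1) ((i' == j)%:R * U0 j j) ^+ 2.
    rewrite (bigD1 j) //= eqxx mul1r big1 ?addr0 // => l /negbTE->.
    by rewrite mul0r expr0n.
  by apply: cvg_sum_entries => i' _; apply: cvgM; exact: Zl.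
have -> : (i == j)%:R = (i == j)%:R * U0 j j / U0 j j.
  by rewrite mulfK // gt_eqF // posU0.
have WE x : W x i j = Z x i / U x j j.
  by rewrite /Z mulfK // gt_eqF // (posU x).2.
under eq_cvg do rewrite WE.
by apply: cvgM; [exact: Zl | apply: cvgV; rewrite ?gt_eqF ?posU0].
Qed.

(** The last column of W is a unit vector orthogonal to the others, so it is
    determined up to sign in the limit; only its squares converge. *)
Lemma qr_factor_cvg_last i : W x i ord_max ^+ 2 @[x --> Phi] --> ((i == ord_max)%:R : R).
Proof.
have WE x : W x i ord_max ^+ 2 = 1 - \sum_(j | j != ord_max) W x i j ^+ 2.
  have : (W x *m (W x)^T) i i = 1 by rewrite (mulmx1C (orthW x)) mxE eqxx.
  rewrite mxE (bigD1 ord_max) //= mxE -expr2 => <-.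
  by under eq_bigr do rewrite mxE -expr2; rewrite addrK.
under eq_cvg do rewrite WE.
have -> : (i == ord_max)%:R = 1 - \sum_(j | j != ord_max) (i == j)%:R ^+ 2 :> R.
  have [->|ni] := eqVneq i ord_max.
    by rewrite big1 ?subr0 // => j nj; rewrite eq_sym (negbTE nj) expr0n.
  rewrite (bigD1 i) //= eqxx expr1n big1 ?addr0 ?subrr // => j /andP[_ nj].
  by rewrite eq_sym (negbTE nj) expr0n.
apply: cvgB; first exact: cvg_cst.
by apply: cvg_sum_entries => j nj; apply: cvgM; exact: qr_factor_cvg_col.
Qed.

(** Changing the sign of the last column of W so that its last entry is nonnegative,
    W tends to the identity.  Undoing the change multiplies by a sign exactly the
    entries of the conjugate whose limit is 0. *)
Lemma conj_cvg (Y : X -> 'M[R]_n.+1) (Y0 : 'M[R]_n.+1) :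
  (forall i j, Y x i j @[x --> Phi] --> Y0 i j) ->
  (forall i j, (i == ord_max) != (j == ord_max) -> Y0 i j = 0) ->
  (W x)^T *m Y x *m W x @[x --> Phi] --> Y0.
Proof.
move=> YY Y00; apply: cvg_mx_entries => i j.
pose sg x : R := (-1) ^+ (W x ord_max ord_max < 0)%R.
pose eps x (k : 'I_n.+1) := if k == ord_max then sg x else 1.
pose V x : 'M[R]_n.+1 := \matrix_(k, l) (W x k l * eps x l).
have V1 k l : V x k l @[x --> Phi] --> ((k == l)%:R : R).
  have [lE|nl] := eqVneq l ord_max; last first.
    apply: (cvg_eqfun (g := fun x => W x k l)); last exact: qr_factor_cvg_col.
    by move=> x; rewrite mxE /eps (negbTE nl) mulr1.
  have W2 := @qr_factor_cvg_last k; rewrite -lE in W2.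
  have VE x : V x k l = W x k l * sg x by rewrite mxE /eps lE eqxx.
  apply: (cvg_eqfun VE); have [kE|nk] := eqVneq k l.
    rewrite kE eqxx in W2 *; apply: (cvg_eqfun (g := fun x => `|W x l l|)).
      by move=> x; rewrite mulrC /sg -lE -normrEsign.
    by rewrite -[true%:R]normr1; apply: cvg_norm_of_sqr; rewrite expr1n.
  rewrite (negbTE nk) in W2; apply: norm_cvg0.
  apply: (cvg_eqfun (g := fun x => `|W x k l|)).
    by move=> x; rewrite normrM normr_sign mulr1.
  by rewrite -(@normr0 R R); apply: cvg_norm_of_sqr; rewrite expr0n.
have VYV : ((V x)^T *m Y x *m V x) i j @[x --> Phi] --> Y0 i j.
  rewrite -[Y0]mulmx1 -[Y0]mul1mx -[X in X *m _ *m _](trmx1 R n.+1).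
  apply: cvg_mulmx_entries => k l; first (apply: cvg_mulmx_entries => // {}k {}l).
  - have trE x : (V x)^T k l = V x l k by rewrite mxE.
    have -> : (1%:M^T : 'M[R]_n.+1) k l = (l == k)%:R by rewrite !mxE.
    by apply: (cvg_eqfun trE); exact: V1.
  - have -> : (1%:M : 'M[R]_n.+1) k l = (k == l)%:R by rewrite !mxE.
    exact: V1.
have sgK x k : eps x k * eps x k = 1.
  by rewrite /eps; case: ifP; rewrite ?mulr1 // -expr2 sqrr_sign.
have VE x : ((W x)^T *m Y x *m W x) i j =
            eps x i * eps x j * ((V x)^T *m Y x *m V x) i j.
  have WE : W x = V x *m diag_mx (\row_l eps x l).
    by apply/matrixP => k l; rewrite mul_mx_diag !mxE -mulrA sgK mulr1.
  rewrite {}WE trmx_mul tr_diag_mx; move: (V x) => V'.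
  by rewrite mulmxA mul_mx_diag mxE -!mulmxA mul_diag_mx !mxE mulrAC.
apply: (cvg_eqfun VE); have [eij|/Y00 Yij] := eqVneq (i == ord_max) (j == ord_max).
  apply: (cvg_eqfun _ VYV) => x.
  by rewrite (_ : eps x i = eps x j) ?sgK ?mul1r // /eps eij.
rewrite Yij in VYV *; apply: norm_cvg0.
apply: (cvg_eqfun (g := fun x => `|((V x)^T *m Y x *m V x) i j|)).
  move=> x; rewrite normrM (_ : `|eps x i * eps x j| = 1) ?mul1r // normrM /eps.
  by do 2![case: ifP => _]; rewrite ?normr_sign ?normr1 mulr1.
by rewrite -(@normr0 R R); apply: cvg_norm.
Qed.

End Limits.

(** * The extended QR map on isospectral matrices *)

Section Isospectral.
Context {R : realType} {m : nat} (lam : 'I_m.+2 -> R).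
Hypothesis lam_inj : injective lam.

Lemma isospectral_diagonalization T : isospectral lam T ->
  exists2 V, orthogonal_mx V & T = V^T *m diag_mx (\row_i lam i) *m V.
Proof.
move=> [symT _ [P uP /(similarP uP) PE]].
exact: orthogonal_diagonalization symT lam_inj uP PE.
Qed.

Lemma isospectral_conj T Q : isospectral lam T -> orthogonal_mx Q ->
  tridiagonal_mx (Q^T *m T *m Q) -> isospectral lam (Q^T *m T *m Q).
Proof.
move=> [symT _ [P uP /(similarP uP) PE]] orthQ tri; split=> //.
  by rewrite !trmx_mul trmxK symT mulmxA.
have [uQT _] := mulmx1_unit orthQ.
have uQP : Q^T *m P \in unitmx by rewrite unitmx_mul uQT.
exists (Q^T *m P) => //; apply/(similarP uQP).
by rewrite -!mulmxA PE !mulmxA -(mulmxA _ Q) (mulmx1C orthQ) mulmx1.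
Qed.

(** Without this the limit in the definition of [F] would be along an improper
    filter, and would say nothing. *)
Lemma regular_closure s T : isospectral lam T -> closure (regular_pairs lam) (s, T).
Proof.
move=> isoT B nB.
have nB' : \forall t \near s^', B (t, T).
  apply: nbhs_dnbhs; case: nB => -[B1 B2] /= [nB1 nB2] sB.
  by apply: filterS nB1 => t B1t; apply: sB; split=> //=; exact: nbhs_singleton.
have far : \forall t \near s^', forall i, t != lam i.
  apply: filter_forall => i; have [si|si] := eqVneq (lam i) s.
    by rewrite si; exact: nbhs_dnbhs_neq.
  apply: nbhs_dnbhs; apply: open_nbhs_nbhs.
  by split; [exact: open_neq | rewrite /= eq_sym].
have [t [Bt ft]] := filter_ex (filterI nB' far).
exists (t, T); split=> //; split=> //=.
by move=> [i _ it]; have := ft i; rewrite it eqxx.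
Qed.

Lemma regular_qr s T : regular_pairs lam (s, T) ->
  exists Q U, [/\ orthogonal_mx Q, pos_upper_mx U, T - s%:M = Q *m U
   & qr_Q (T - s%:M) = Q].
Proof.
move=> [/= ns isoT]; have [V orthV TE] := isospectral_diagonalization isoT.
have uT : T - s%:M \in unitmx.
  rewrite (shifted_unit s orthV TE); apply/forallP => i.
  by apply/eqP => si; apply: ns; exists i.
have [Q [U [orthQ posU QU]]] := qr_exists uT.
have ex : exists Q', orthogonal_mx Q' /\
    exists2 U', pos_upper_mx U' & T - s%:M = Q' *m U'.
  by exists Q; split=> //; exists U.
have [orthQ' [U' posU' QU']] := xgetPex 1%:M ex.
by exists (qr_Q (T - s%:M)), U'.
Qed.

Lemma F_eigenvalue s T Q U : s \in codom lam -> isospectral lam T ->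
  qr_pair (T - s%:M) Q U -> F lam s T = Q^T *m T *m Q.
Proof.
move=> s_eig isoT qrT; have [orthQ upU posU QU] := qrT.
rewrite /F s_eig.
have [V orthV TE] := isospectral_diagonalization isoT.
have [symT triT _] := isoT.
(* T - s is singular, so its only unconstrained pivot vanishes. *)
have U_last : U ord_max ord_max = 0.
  apply/eqP; apply/negPn/negP => Un.
  have : T - s%:M \in unitmx.
    rewrite QU unitmx_mul (mulmx1_unit orthQ).2 /= -unitmx_tr unitmxE det_trig //.
    rewrite unitfE prodf_seq_neq0; apply/allP => i _; rewrite mxE.
    by have [->//|/posU] := eqVneq i ord_max; rewrite lt0r => /andP[].
  rewrite (shifted_unit s orthV TE) => /forallP.
  by move/codomP: s_eig => [i ->] /(_ i); rewrite eqxx.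
pose Y0 := Q^T *m T *m Q.
have symY0 : Y0^T = Y0 by rewrite /Y0 !trmx_mul trmxK symT mulmxA.
have Y0_last j : j != ord_max -> Y0 ord_max j = 0.
  move=> nj; rewrite /Y0 (qr_pair_conjE qrT) !mxE eq_sym (negbTE nj) add0r big1 // => k _.
  have [->|nk] := eqVneq k ord_max; first by rewrite U_last mul0r.
  have /is_trig_mxP/(_ k ord_max) := upU; rewrite mxE => -> //; first by rewrite mul0r.
  exact: ltn_ord_max.
set D := regular_pairs lam.
have PF : ProperFilter (within D (nbhs (s, T))).
  by apply: within_nbhs_proper; exact: regular_closure.
(* Total QR factors, trivial off the regular pairs, so that the convergence lemma
   applies without restriction on the argument. *)
have /choice[qu quP] : forall p : R * 'M[R]_m.+2, exists qu : 'M[R]_m.+2 * 'M[R]_m.+2,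
    [/\ orthogonal_mx qu.1, pos_upper_mx qu.2 &
      D p -> p.2 - p.1%:M = qu.1 *m qu.2 /\ qr_Q (p.2 - p.1%:M) = qu.1].
  move=> [t S]; have [/regular_qr[Q' [U' [? ? ? ?]]]|nD] := pselect (D (t, S)).
    by exists (Q', U').
  exists (1%:M, 1%:M); split=> //=; first by rewrite /orthogonal_mx trmx1 mulmx1.
  split=> [|i]; last by rewrite mxE eqxx.
  by rewrite trmx1 scalar_mx_is_trig.
have cvg_fst1 : p.1 @[p --> within D (nbhs (s, T))] --> s.
  by apply: cvg_within_filter; exact: cvg_fst.
have cvg_entry (i j : 'I_m.+2) : (p.2 : 'M[R]_m.+2) i j @[p --> within D (nbhs (s, T))] --> T i j.
  apply: cvg_within_filter.
  apply: (@cvg_comp _ _ _ snd (fun M : 'M[R]_m.+2 => M i j) _ (nbhs T)).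
    exact: cvg_snd.
  exact: coord_continuous.
have cvgQ (S : R * 'M[R]_m.+2 -> 'M[R]_m.+2) (S0 : 'M[R]_m.+2) :
  (forall i j, S p i j @[p --> within D (nbhs (s, T))] --> S0 i j) ->
  forall i j, (Q^T *m S p) i j @[p --> within D (nbhs (s, T))] --> (Q^T *m S0) i j.
  by move=> SS; apply: cvg_mulmx_entries => // k l; exact: cvg_cst.
have WU i j : ((Q^T *m (qu p).1) *m (qu p).2) i j
    @[p --> within D (nbhs (s, T))] --> U i j.
  rewrite (_ : U = Q^T *m (T - s%:M)); last by rewrite QU mulmxA orthQ mul1mx.
  have sh (k l : 'I_m.+2) : (p.2 - p.1%:M) k l @[p --> within D (nbhs (s, T))] --> (T - s%:M) k l.
    have shE (p : R * 'M[R]_m.+2) : (p.2 - p.1%:M) k l = p.2 k l - p.1 *+ (k == l).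
      by rewrite !mxE.
    have -> : (T - s%:M) k l = T k l - s *+ (k == l) by rewrite !mxE.
    apply: (cvg_eqfun shE); apply: cvgB => //.
    by case: (k == l); [exact: cvg_fst1 | exact: cvg_cst].
  apply: cvg_trans (near_eq_cvg _) (cvgQ _ _ sh i j).
  apply: filterS (withinT _ _) => p Dp; have [_ _ /(_ Dp)[-> _]] := quP p.
  by rewrite mulmxA.
apply: cvg_lim; first exact: norm_hausdorff.
have orthW p : orthogonal_mx (Q^T *m (qu p).1).
  have [orthq _ _] := quP p.
  by rewrite /orthogonal_mx trmx_mul trmxK -mulmxA [Q *m _]mulmxA (mulmx1C orthQ) mul1mx.
have posq p : pos_upper_mx (qu p).2 by have [] := quP p.
have Y0_entries i j : (i == ord_max) != (j == ord_max) -> Y0 i j = 0.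
  have [->|ni] := eqVneq i ord_max; have [->|nj] := eqVneq j ord_max => // _.
    exact: Y0_last.
  by rewrite -symY0 mxE Y0_last.
have YY i j : (Q^T *m (p.2 : 'M[R]_m.+2) *m Q) i j @[p --> within D (nbhs (s, T))] --> Y0 i j.
  apply: cvg_mulmx_entries => [k l|k l]; last exact: cvg_cst.
  exact: cvgQ.
apply: cvg_trans (conj_cvg orthW posq upU posU WU YY Y0_entries).
apply: near_eq_cvg.
apply: filterS (withinT _ _) => p Dp; have [_ _ /(_ Dp)[_ qE]] := quP p.
rewrite /qr_step qE trmx_mul trmxK !mulmxA -(mulmxA _ Q) (mulmx1C orthQ) mulmx1.
by rewrite -(mulmxA _ Q) (mulmx1C orthQ) mulmx1.
Qed.

(** Both branches of the definition of [F] in one: whether or not s is an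
    eigenvalue, F s T is the conjugate of T by an orthogonal factor of T - s. *)
Lemma F_qr_pair s T : isospectral lam T ->
  (forall x : 'cV[R]_m.+2, x ord_max 0 = 0 -> (T - s%:M) *m x = 0 -> x = 0) ->
  exists Q U, qr_pair (T - s%:M) Q U /\ F lam s T = Q^T *m T *m Q.
Proof.
move=> isoT inj; have [s_eig|s_reg] := boolP (s \in codom lam).
  have [Q [U qrT]] := qr_pair_exists inj.
  by exists Q, U; split=> //; apply: F_eigenvalue qrT.
have [|Q [U [orthQ [upU posU] QU qE]]] := regular_qr (s := s) (T := T).
  split=> //= -[i _ is_]; move/negP: s_reg; apply; apply/codomP.
  by exists i.
exists Q, U; split; first by split=> // i _; exact: posU.
by rewrite /F (negbTE s_reg) /qr_step /= qE.
Qed.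

End Isospectral.

(** * Cubic convergence *)

Lemma spectral_gap_exists (R : realType) n (lam : 'I_n -> R) : injective lam ->
  exists2 g : R, 0 < g & forall i j, i != j -> g <= `|lam i - lam j|.
Proof.
move=> lam_inj.
exists (\big[Num.min/1]_(p : 'I_n * 'I_n | p.1 != p.2) `|lam p.1 - lam p.2|).
  apply/bigmin_gtP; split=> // -[i j] /= ij.
  by rewrite normr_gt0 subr_eq0; apply: contraNneq ij => /lam_inj ->.
by move=> i j ij; exact: (bigmin_le_cond 1 (j := (i, j))).
Qed.

Theorem theorem4p2 (R : realType) (m : nat) (lam : 'I_m.+2 -> R)
  (lam_incr : forall i j : 'I_m.+2, (i < j)%N -> lam i < lam j) :
  exists eps c : R,
    [/\ 0 < eps,
        0 < c,
        deflation lam eps `<=` dom_G lam,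
        G lam @` deflation lam eps `<=` deflation lam eps
      & forall T : 'M[R]_m.+2, deflation lam eps T ->
          `|subdiag (G lam T)| <= c * `|subdiag T| ^+ 3].
Proof.
have lam_inj : injective lam.
  move=> i j ij; have [lt|lt|/val_inj//] := ltngtP i j; have := lam_incr _ _ lt;
  by rewrite ij ltxx.
have [g g_gt0 gap] := spectral_gap_exists lam_inj.
have step T : deflation lam (g / 4) T -> isospectral lam (G lam T) /\
    `|subdiag (G lam T)| <= 8 / g ^+ 2 * `|subdiag T| ^+ 3.
  move=> [isoT small]; have [symT triT _] := isoT.
  have [V orthV TE] := isospectral_diagonalization lam_inj isoT.
  have inj := deflated_inj symT triT orthV TE g_gt0 gap small.
  have [Q [U [qrT GE]]] := F_qr_pair lam_inj isoT inj.
  rewrite /G GE; split; last first.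
    by have := cubic_bound symT triT orthV TE g_gt0 gap small qrT.
  have [orthQ _ _ _] := qrT.
  have tri := qr_pair_tridiagonal symT triT qrT.
  by have := isospectral_conj isoT orthQ tri.
exists (g / 4), (8 / g ^+ 2); split.
- by rewrite divr_gt0.
- by rewrite divr_gt0 ?exprn_gt0.
- move=> T [isoT small]; split=> //; set s := rayleigh T.
  have [symT triT _] := isoT.
  have [V orthV TE] := isospectral_diagonalization lam_inj isoT.
  have inj := deflated_inj symT triT orthV TE g_gt0 gap small.
  have [[i _ lam_i]|s_reg] := pselect (range lam s); last by left.
  right; exists i => //; split => //.
  (* Otherwise x, row i of V, would be a kernel vector of T - s without last
     component. *)
  have Vin : V i ord_max != 0.
    apply/eqP => Vin; pose x := V^T *m delta_mx i (0 : 'I_1).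
    have x0 : x = 0.
      apply: inj; first by rewrite /x -colE !mxE.
      rewrite (shifted_spectral s orthV TE) /x -!mulmxA [V *m _]mulmxA.
      rewrite (mulmx1C orthV) mul1mx.
      rewrite (_ : diag_mx _ *m _ = 0) ?mulmx0 //.
      apply/colP => k; rewrite mul_diag_mx !mxE.
      by have [->|_] := eqVneq k i; rewrite ?lam_i ?subrr ?mul0r ?mulr0.
    have : V *m x = delta_mx i 0 by rewrite /x mulmxA (mulmx1C orthV) mul1mx.
    move/colP/(_ i); rewrite x0 mulmx0 !mxE !eqxx => /eqP.
    by rewrite eq_sym oner_eq0.
  have [pi [Q [pi_last orthQ posQ TQ]]] := lu_positive_reordering lam orthV Vin.
  exists pi => //; split=> //; exists Q; split=> //.
  by rewrite TE TQ.
- move=> _ [T defT <-]; have [isoG cub] := step T defT; split=> //.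
  apply: le_trans cub _; have [_ small] := defT.
  have b0 := normr_ge0 (subdiag T).
  (* c eps^2 = 1 / 2. *)
  have b2 : `|subdiag T| ^+ 2 <= g ^+ 2 / 16 by nra.
  rewrite (exprSr `|subdiag T|) mulrA; apply: le_trans small; rewrite ler_piMl //.
  by rewrite mulrAC ler_pdivrMr ?exprn_gt0 //; have := sqr_ge0 g; lra.
- by move=> T /step[].
Qed.
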